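(* Let $G$ be a generator over an alphabet $A$, with sets of locally controllable events $A_{c,i}\subseteq A$ and locally observable events $A_{o,i}\subseteq A$, $i=1,\dots,n$. Let $A_c=\bigcup_i A_{c,i}$, $A_{uc}=A\setminus A_c$, and assume full observations: $\bigcup_i A_{o,i}=A$. Let $L=L(G)$ and let $K\subseteq L$, where $K$ and $L$ are prefix-closed. Let $\Sigma_1,\dots,\Sigma_n\subseteq A$ be extensions of $A_{o,1},\dots,A_{o,n}$ such that both $K$ and $L$ are separable with respect to $(A_{o,i}\cup\Sigma_i)_{i=1}^n$. Let $\Sigma_{c,i}=\Sigma_i\cap A_c$ and assume $(A_{o,i}\cup\Sigma_i)\cap A_c\subseteq A_{c,i}\cup\Sigma_{c,i}$ for all $i$. Let $P_{i+\Sigma_i}\colon A^*\to(A_{o,i}\cup\Sigma_i)^*$ be the projection and let $$\sup\mathrm{C}_{i+\Sigma_i}=\sup\mathrm{C}\bigl(P_{i+\Sigma_i}(K),P_{i+\Sigma_i}(L),(A_{o,i}\cup\Sigma_i)\cap A_{uc}\bigr).$$ If $P_{i+\Sigma_i}(L)$ and $P_{j+\Sigma_j}(L)$ are mutually controllable, for $i,j=1,2,\ldots,n$, then $$\parallel_{i=1}^n\sup\mathrm{C}_{i+\Sigma_i}=\sup\mathrm{C}(K,L,A_{uc}),$$ and this language is coobservable with respect to $L$ and $(A_{o,i}\cup\Sigma_i)_{i=1}^n$.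
   Context: An alphabet is a finite nonempty set of events; all languages are assumed regular. A generator $G=(Q,A,f,q_0,Q_m)$ is a deterministic finite automaton with partial transition function $f$; its generated language is $L(G)=\{s\in A^*\mid f(q_0,s)\text{ is defined}\}$. $\overline{L}$ denotes the prefix closure of $L$; $L$ is prefix-closed if $L=\overline L$. For $Y\subseteq X$, the projection $X^*\to Y^*$ is the monoid morphism erasing the events of $X\setminus Y$ and keeping those of $Y$. For $L_i\subseteq X_i^*$, $X=\bigcup_i X_i$, the synchronous product is $\parallel_i L_i=\bigcap_i P_i^{-1}(L_i)\subseteq X^*$, with $P_i\colon X^*\to X_i^*$ the projections. $K\subseteq X^*$ is separable with respect to $(X_i)_i$ if $K=\parallel_i P_i(K)$. For a prefix-closed $N\subseteq X^*$ and $X_{uc}\subseteq X$, a language $M\subseteq N$ is controllable with respect to $N$ and $X_{uc}$ if $\overline{M}X_{uc}\cap N\subseteq\overline{M}$. $\sup\mathrm{C}(M,N,X_{uc})$ denotes the supremal (largest) sublanguage of $M$ that is controllable with respect to $N$ and $X_{uc}$ (it exists, since controllability is preserved by unions). Prefix-closed languages $L_i\subseteq X_i^*$, $i=1,\dots,n$, with $X_i\subseteq A$, $\bigcup_i X_i=A$ and projections $P_i\colon A^*\to X_i^*$, are mutually controllable if $L_j(X_i\cap A_{uc}\cap X_j)\cap P_jP_i^{-1}(L_i)\subseteq L_j$ for all $i,j$. Given local observable alphabets $O_i\subseteq A$ and local controllable alphabets $C_i\subseteq A$ with $\bigcup_i C_i=A_c$, a language $M\subseteq L$ is coobservable with respect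 to $L$ and $(O_i)_{i=1}^n$ if for all $s\in\overline{M}$ and $a\in A_c$ with $sa\in L\setminus\overline{M}$ there is $i$ such that $a\in C_i$ and $Q_i^{-1}(Q_i(s))\{a\}\cap\overline{M}=\emptyset$, where $Q_i\colon A^*\to O_i^*$ is the projection. Here $O_i=A_{o,i}\cup\Sigma_i$ and the (extended) local controllable alphabets are $C_i=A_{c,i}\cup\Sigma_{c,i}$. *)

(* Defs.v *)
From HB Require Import structures.
From mathcomp Require Import all_boot.
From mathcomp Require Import boolp classical_sets.

Set Implicit Arguments.
Unset Strict Implicit.
Unset Printing Implicit Defensive.

Local Open Scope classical_set_scope.

(* Finite words over A are [seq A]; a subalphabet is some X : {set A}, and X^*
   is represented inside [seq A] by the words all of whose letters lie in X.
   A language is a set of words, so a language over X is a subset of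
   [words X]. *)

Section Languages.
Variable A : finType.

Definition language := set (seq A).

Implicit Types (X : {set A}) (K L M N : language) (s w : seq A) (a : A).

Definition words X : language := [set w | all (mem X) w].

Definition prefix_closure L : language := [set s | exists t, L (s ++ t)].

Definition prefix_closed L : Prop := L = prefix_closure L.

Definition proj X (w : seq A) : seq A := [seq a <- w | a \in X].

(* The concatenation L X, where the letters of X are read as words of
   length one. *)
Definition cat_events L X : language :=
  [set rcons s a | s in L & a in [set` X]].

Record generator := Generator {
  gstate : finType;
  gtrans : gstate -> A -> option gstate;
  ginit : gstate;
  gmarked : {set gstate} }.

Definition grun (G : generator) (w : seq A) : option (gstate G) :=
  foldl (fun oq a => obind (fun q => gtrans q a) oq) (Some (ginit G)) w.

Definition generated (G : generator) : language := [set w | isSome (grun G w)].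

Definition marked (G : generator) : language :=
  [set w | exists2 q, grun G w = Some q & q \in gmarked G].

Definition regular L : Prop := exists G : generator, L = marked G.

Definition controllable N (Xuc : {set A}) M : Prop :=
  M `<=` N /\ cat_events (prefix_closure M) Xuc `&` N `<=` prefix_closure M.

(* The largest sublanguage is taken as the union of all candidates; see
   [supC_sub], [supC_controllable] and [supC_max]. *)
Definition supC M N (Xuc : {set A}) : language :=
  [set w | exists2 M', M' `<=` M /\ controllable N Xuc M' & M' w].

Lemma supC_sub M N (Xuc : {set A}) : supC M N Xuc `<=` M.
Proof. by move=> w [M' [sM' _]] /sM'. Qed.

Lemma supC_max M N (Xuc : {set A}) M' :
  M' `<=` M -> controllable N Xuc M' -> M' `<=` supC M N Xuc.
Proof. by move=> sM' cM' w M'w; exists M'. Qed.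

Lemma supC_controllable M N (Xuc : {set A}) :
  controllable N Xuc (supC M N Xuc).
Proof.
split=> [w [M' [_ [sN _]]] /sN //|_ [[s [t [M' [sM' cM'] M'st]] [a Xa <-]] Nsa]].
have [|t' M't'] := cM'.2 (rcons s a); last by exists t', M'.
by split=> //; exists s; [exists t | exists a].
Qed.

Section Families.
Variable n : nat.

(* The synchronous product is a language over the union of the X i. *)
Definition sync (X : 'I_n -> {set A}) (Ls : 'I_n -> language) : language :=
  words (\bigcup_i X i)%SET `&` \bigcap_i (proj (X i) @^-1` Ls i).

Definition separable (X : 'I_n -> {set A}) K : Prop := K = sync X (fun i => proj (X i) @` K).

Definition mutually_controllable (Auc : {set A}) (X : 'I_n -> {set A})
    (Ls : 'I_n -> language) : Prop :=
  forall i j : 'I_n,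
    cat_events (Ls j) (X i :&: Auc :&: X j)%SET
      `&` proj (X j) @` (proj (X i) @^-1` Ls i) `<=` Ls j.

(* The set of all controllable events is the union of the C i. *)
Definition coobservable L (O C : 'I_n -> {set A}) M : Prop :=
  M `<=` L /\
  forall s a, prefix_closure M s -> a \in (\bigcup_i C i)%SET ->
    (L `\` prefix_closure M) (rcons s a) ->
    exists i, a \in C i /\
      cat_events (proj (O i) @^-1` [set proj (O i) s]) [set a]%SET
        `&` prefix_closure M = set0.

End Families.
End Languages.

(* Main.v *)
Require Import Defs.
From HB Require Import structures.
From mathcomp Require Import all_boot.
From mathcomp Require Import boolp classical_sets.

(** The two inclusions of the equality rest on different hypotheses.

    A synchronous product of prefix-closed locally controllable languages is
    controllable with respect to the product of the local plants
    ([controllable_sync]): an uncontrollable event either is invisible to a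
    component or is one that the component already allows. As K and L are the
    products of their projections, the product of the local suprema is therefore
    a controllable sublanguage of K.

    Conversely, the supremal language S of the whole system lies in the product
    of the local suprema as soon as each of its projections is locally
    controllable ([controllable_proj]). The danger is that P_i(s)a lies in
    P_i(L) only because of some word of L other than s, while sa is not in L, so
    that the controllability of S says nothing. Mutual controllability excludes
    this: it carries the permission for a from component i to every component
    that shares a, and separability of L turns these local permissions into
    membership of sa in L.

    Coobservability holds for every synchronous product of prefix-closed
    languages inside L in which a component may disable each controllable event
    that it observes ([coobservable_sync]): if sa leaves the product, then one component i rejects
    P_i(s)a, and this verdict depends on s only through P_i(s), so that component
    alone can disable a after every word that looks like s to it. *)

Set Implicit Arguments.
Unset Strict Implicit.
Unset Printing Implicit Defensive.

Local Open Scope classical_set_scope.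

Section Auxiliary.
Variable A : finType.
Implicit Types (X U : {set A}) (K L M N : language A) (s t u v w : seq A) (a : A).

Lemma proj_cat X s t : proj X (s ++ t) = proj X s ++ proj X t.
Proof. exact: filter_cat. Qed.

Lemma proj_rcons X s a :
  proj X (rcons s a) = if a \in X then rcons (proj X s) a else proj X s.
Proof. exact: filter_rcons. Qed.

Lemma proj_eq_cat X w u v :
  proj X w = u ++ v -> exists s t, [/\ w = s ++ t, proj X s = u & proj X t = v].
Proof.
elim: w u => [|a w IHw] u /=; first by case: u => [/= <-|//]; exists [::], [::].
case: u => [/= <-|b u]; first by exists [::], (a :: w).
case: ifPn => [Xa [<-] /IHw | Xa /(IHw (b :: u))] [s [t [-> <- <-]]].
  by exists (a :: s), t; rewrite /= Xa.
by exists (a :: s), t; rewrite /= (negPf Xa).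
Qed.

Lemma sub_prefix_closure L : L `<=` prefix_closure L.
Proof. by move=> s Ls; exists [::]; rewrite cats0. Qed.

Lemma prefix_closureS L M : L `<=` M -> prefix_closure L `<=` prefix_closure M.
Proof. by move=> sLM s [t /sLM]; exists t. Qed.

Lemma prefix_closedP L : prefix_closed L <-> prefix_closure L `<=` L.
Proof.
split=> [<- // | sL]; apply/seteqP; split=> //; exact: sub_prefix_closure.
Qed.

Lemma prefix_closure_closed L : prefix_closed (prefix_closure L).
Proof.
by apply/prefix_closedP => s [t [u]]; rewrite -catA; exists (t ++ u).
Qed.

Lemma prefix_closed_proj X L : prefix_closed L -> prefix_closed (proj X @` L).
Proof.
move=> /prefix_closedP pL; apply/prefix_closedP => u [v [w Lw]].
case/proj_eq_cat=> s [t [ew eu _]]; exists s => //.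
by apply: pL; exists t; rewrite -ew.
Qed.

Lemma controllableP N U M : prefix_closed M ->
  controllable N U M <->
  M `<=` N /\
  forall s a, M s -> a \in U -> N (rcons s a) -> M (rcons s a).
Proof.
move=> pM; rewrite /controllable -pM; split=> -[sMN cM]; split=> //.
  by move=> s a Ms Ua Nsa; apply: cM; split=> //; exists s => //; exists a.
by move=> _ [[s Ms [a Ua <-]] Nsa]; apply: cM.
Qed.

(** The prefix closure of a candidate is again a candidate, hence below the
    supremum. *)
Lemma supC_prefix_closed M N U :
  prefix_closed M -> prefix_closed N -> prefix_closed (supC M N U).
Proof.
move=> pM pN; apply/prefix_closedP; apply: supC_max.
  by rewrite [X in _ `<=` X]pM; apply: prefix_closureS; apply: supC_sub.
have [sN cM] := supC_controllable M N U.
split; first by rewrite [X in _ `<=` X]pN; apply: prefix_closureS.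
by rewrite -prefix_closure_closed.
Qed.

Section Families.
Variable n : nat.
Implicit Types (Xs Cs : 'I_n -> {set A}) (Ls Ns : 'I_n -> language A).

Lemma sync_monotone Xs Ls Ns :
  (forall i, Ls i `<=` Ns i) -> sync Xs Ls `<=` sync Xs Ns.
Proof. by move=> sLN w [Xw Lw]; split=> // i _; apply/sLN/Lw. Qed.

Lemma prefix_closed_sync Xs Ls :
  (forall i, prefix_closed (Ls i)) -> prefix_closed (sync Xs Ls).
Proof.
move=> pL; apply/prefix_closedP => s [t [Xst Lst]]; split.
  by move: Xst; rewrite /words /= all_cat => /andP[].
move=> i _; have /prefix_closedP := pL i; apply.
by exists (proj (Xs i) t); rewrite -proj_cat; apply: Lst.
Qed.

(** Components that do not see the event keep the same projection, and the
    others allow it because it is uncontrollable for them too. *)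
Lemma controllable_sync Xs U Ls Ns :
  (forall i, prefix_closed (Ls i)) ->
  (forall i, controllable (Ns i) (Xs i :&: U)%SET (Ls i)) ->
  controllable (sync Xs Ns) U (sync Xs Ls).
Proof.
move=> pL cL; apply/controllableP; first exact: prefix_closed_sync.
split=> [|s a [_ Ls_s] Ua [Xsa Ns_sa]].
  by apply: sync_monotone => i; have [] := cL i.
split=> // i _; have /(controllableP _ _ (pL i))[_ cLi] := cL i.
have := Ns_sa i I; have := Ls_s i I; rewrite /preimage /= proj_rcons.
by case: ifP => // Xa Lis; apply: cLi; rewrite // inE Xa.
Qed.

(** With L separable and mutually controllable, an uncontrollable event allowed
    after [proj (Xs i) s] in component i is allowed after s itself in L, so that
    controllability of M with respect to L applies. *)
Lemma controllable_proj Xs U L M i :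
  separable Xs L ->
  (\bigcup_j Xs j)%SET = [set: A]%SET ->
  mutually_controllable U Xs (fun j => proj (Xs j) @` L) ->
  prefix_closed M -> controllable L U M ->
  controllable (proj (Xs i) @` L) (Xs i :&: U)%SET (proj (Xs i) @` M).
Proof.
move=> sepL covX mcL pM /(controllableP _ _ pM)[sML cM].
apply/controllableP; first exact: prefix_closed_proj.
split=> [|_ a [s Ms <-] /setIP[Xia Ua] Lisa]; first exact: image_subset.
have Pisa : proj (Xs i) (rcons s a) = rcons (proj (Xs i) s) a.
  by rewrite proj_rcons Xia.
exists (rcons s a) => //; apply: cM => //; rewrite sepL; split.
  by apply/allP => b _; rewrite /= covX inE.
move=> j _; have Ljs : (proj (Xs j) @` L) (proj (Xs j) s).
  by exists s => //; apply: sML.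
rewrite /preimage /=; have [Xja | Xja] := boolP (a \in Xs j); last first.
  by rewrite proj_rcons (negPf Xja).
apply: (mcL i j); split; last by exists (rcons s a); rewrite // /preimage /= Pisa.
exists (proj (Xs j) s) => //; exists a; last by rewrite proj_rcons Xja.
by rewrite /= !inE Xia Ua.
Qed.

(** The component that rejects sa also rejects s'a for every s' with the same
    projection as s. *)
Lemma coobservable_sync L Xs Cs Ls :
  (forall i, prefix_closed (Ls i)) ->
  sync Xs Ls `<=` L ->
  (\bigcup_i Xs i)%SET = [set: A]%SET ->
  (forall i, (Xs i :&: \bigcup_j Cs j)%SET \subset Cs i) ->
  coobservable L Xs Cs (sync Xs Ls).
Proof.
move=> pL sL covX sXC; split=> // s a.
rewrite -(prefix_closed_sync _ pL) => -[Xs_s Ls_s] Ca [_ nMsa].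
have /existsNP[i nLisa] : ~ forall i, Ls i (proj (Xs i) (rcons s a)).
  move=> Lsa; apply: nMsa; split=> [|i _]; last exact: Lsa.
  by apply/allP => b _; rewrite /= covX inE.
have Xia : a \in Xs i.
  apply: contra_notT nLisa => Xia.
  by rewrite proj_rcons (negPf Xia); apply: Ls_s.
exists i; split; first by apply: (fintype.subsetP (sXC i)); rewrite inE Xia.
apply/seteqP; split=> // _ [[s' Ps' [b /set1P-> <-]] [_ Ls'a]].
apply: nLisa; have := Ls'a i I.
by rewrite /preimage /= !proj_rcons Xia Ps'.
Qed.

End Families.
End Auxiliary.

Theorem theorem10 (A : finType) (A_nonempty : (0 < #|A|)%N)
    (G : generator A) (n : nat)
    (Ac_ Ao_ Sigma : 'I_n -> {set A}) (K : language A) :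
  let Ac := (\bigcup_i Ac_ i)%SET in
  let Auc := (~: Ac)%SET in
  let L := generated G in
  let X := fun i => (Ao_ i :|: Sigma i)%SET in
  let Sigmac := fun i => (Sigma i :&: Ac)%SET in
  let C := fun i => (Ac_ i :|: Sigmac i)%SET in
  let supC_ := fun i =>
    supC (proj (X i) @` K) (proj (X i) @` L) (X i :&: Auc)%SET in
  (\bigcup_i Ao_ i)%SET = [set: A]%SET ->
  regular K ->
  K `<=` L ->
  prefix_closed K ->
  prefix_closed L ->
  separable X K ->
  separable X L ->
  (forall i, (X i :&: Ac)%SET \subset C i) ->
  mutually_controllable Auc X (fun i => proj (X i) @` L) ->
  sync X supC_ = supC K L Auc /\ coobservable L X C (sync X supC_).
Proof.
move=> Ac Auc L X Sigmac C supC_ covAo _ sKL pK pL sepK sepL sXC mcL.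
have covX : (\bigcup_i X i)%SET = [set: A]%SET.
  apply/setP => a; rewrite inE; apply/bigcupP.
  have /bigcupP[i _ Aoa] : a \in (\bigcup_i Ao_ i)%SET by rewrite covAo inE.
  by exists i => //; rewrite inE Aoa.
have psupC i : prefix_closed (supC_ i).
  by apply: supC_prefix_closed; apply: prefix_closed_proj.
have sub_sync_K : sync X supC_ `<=` K.
  by rewrite sepK; apply: sync_monotone => i; apply: supC_sub.
split.
  apply/seteqP; split.
    apply: supC_max => //; rewrite sepL.
    by apply: controllable_sync => // i; apply: supC_controllable.
  move=> w Sw; split; first by apply/allP => b _; rewrite /= covX inE.
  move=> i _; have Siw : (proj (X i) @` supC K L Auc) (proj (X i) w).
    by exists w.
  apply: supC_max Siw; first by apply: image_subset; apply: supC_sub.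
  apply: controllable_proj => //; first exact: supC_prefix_closed.
  exact: supC_controllable.
apply: coobservable_sync => // [|i]; first exact: subset_trans sub_sync_K sKL.
apply: fintype.subset_trans (sXC i); apply: finset.setIS; apply/finset.bigcupsP => j _.
by rewrite finset.subUset (finset.bigcup_sup j) //= finset.subsetIr.
Qed.
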